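(* Let $0<\alpha<1$, $\tau>0$, let $\lambda$ be a (real or complex) constant, let $f:[0,+\infty)\to\mathbb{R}$ be continuous, and let $\phi(t)\equiv y_0$ for $t\in[-\tau,0]$, for some $y_0\in\mathbb{R}$. Then for every $t\ge0$ the exact solution of $$ {}^{C}\!D^{\alpha}_{0}y(t)=\lambda y(t-\tau)+f(t)\ (t>0),\qquad y(t)=\phi(t)\ (-\tau\le t\le0) $$ is $$ y(t)=\sum_{k=0}^{\lfloor t/\tau\rfloor+1}\frac{\lambda^{k}(t+\tau-k\tau)^{\alpha k}}{\Gamma(\alpha k+1)}\,y_0+\mathcal{J}_{0,\tau,\lambda}f(t). $$
   Context: The Caputo derivative is ${}^{C}\!D^{\alpha}_{0}y=J_0^{1-\alpha}y'$, where $J_0^{\beta}u(t)=\frac{1}{\Gamma(\beta)}\int_0^t(t-r)^{\beta-1}u(r)\,dr$. A solution of the delay problem is a continuous function $y$ on $[-\tau,\infty)$ with $y=\phi$ on $[-\tau,0]$ satisfying the equation in its equivalent integral form $y(t)=\phi(0)+\frac{1}{\Gamma(\alpha)}\int_0^t(t-r)^{\alpha-1}\bigl[\lambda y(r-\tau)+f(r)\bigr]dr$ for $t\ge0$. The generalized integral is $$\mathcal{J}_{0,\tau,\lambda}f(t):=\sum_{k=0}^{\lfloor t/\tau\rfloor}\frac{\lambda^k}{\Gamma(\alpha k+\alpha)}\int_0^{t-k\tau}(t-k\tau-r)^{\alpha k+\alpha-1}f(r)\,dr .$$ *)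

(* Defs.v *)
(* MathComp-Analysis, with R[i] from mathcomp-real-closed for complex scalars. *)
From mathcomp Require Import all_boot all_order all_algebra.
From mathcomp Require Import all_classical all_reals all_analysis.
From mathcomp Require Export complex.

Set Implicit Arguments.
Unset Strict Implicit.
Unset Printing Implicit Defensive.

Import Order.TTheory GRing.Theory Num.Theory.
Import numFieldNormedType.Exports.

Local Open Scope classical_set_scope.
Local Open Scope ring_scope.
Local Open Scope complex_scope.

(* Euler's second integral; meant for 0 < s. *)
Definition Gamma (R : realType) (s : R) : R :=
  \int[@lebesgue_measure R]_(x in `]0, +oo[) (x `^ (s - 1) * expR (- x)).

(* Integral of a complex-valued function, componentwise. *)
Definition Cintegral (R : realType) (D : set R) (g : R -> R[i]) : R[i] :=
  (\int[@lebesgue_measure R]_(x in D) complex.Re (g x)) +i*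
  (\int[@lebesgue_measure R]_(x in D) complex.Im (g x)).

(* J_0^beta u (t), the Riemann-Liouville integral of order beta > 0. The kernel
   is singular at r = t when beta < 1, where powR takes the value 0; this only
   affects a null set. *)
Definition RL_integral (R : realType) (beta : R) (u : R -> R[i]) (t : R) :
    R[i] :=
  ((Gamma beta)^-1)%:C *
  Cintegral `[0, t] (fun r => ((t - r) `^ (beta - 1))%:C * u r).

(* Only the values of f on [0, +oo[, of phi on [-tau, 0] and of y on
   [-tau, +oo[ are relevant. The topology on R[i] is that of its modulus. The
   equation  ^C D^alpha_0 y (t) = lambda * y (t - tau) + f t  is taken in its
   integral form: y is not required to be differentiable. *)
Definition delay_solution (R : realType) (alpha tau : R) (lambda : R[i])
    (f phi : R -> R) (y : R -> R[i]) : Prop :=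
  [/\ {within `[- tau, +oo[, continuous (y : R -> (R[i] : numFieldType))},
      forall t, - tau <= t <= 0 -> y t = (phi t)%:C &
      forall t, 0 <= t ->
        y t = (phi 0)%:C +
          RL_integral alpha (fun r => lambda * y (r - tau) + (f r)%:C) t].

(* Num.truncn is the floor on nonnegative reals; meant for 0 <= t. *)
Definition delay_integral (R : realType) (alpha tau : R) (lambda : R[i])
    (f : R -> R) (t : R) : R[i] :=
  \sum_(0 <= k < (Num.truncn (t / tau)).+1)
    lambda ^+ k / (Gamma (alpha * k%:R + alpha))%:C *
    (\int[@lebesgue_measure R]_(r in `[0, t - k%:R * tau])
       ((t - k%:R * tau - r) `^ (alpha * k%:R + alpha - 1) * f r))%:C.

(* Main.v *)
(* On causal functions, J_0^b is the convolution with the kernel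
   k_b(x) = x^(b-1) / Gamma(b) (x > 0). The Beta integral says k_a * k_b = k_(a+b),
   hence J^a J^b = J^(a+b), and convolution commutes with delays. Writing
   y = y0 + z, the equation reads
   z(t) = (J^alpha w)(t) + lambda (J^alpha z)(t - tau) with w = lambda y0 + f, so
   iterating it gives z(t) = sum_k lambda^k (J^(alpha (k+1)) w)(t - k tau), where the terms with
   k tau >= t vanish; J^b 1 (t) = t^b / Gamma(b + 1) turns this into the stated
   formula. *)
Require Import Defs.
From mathcomp Require Import all_boot all_order all_algebra.
From mathcomp Require Import all_classical all_reals all_analysis.
From mathcomp Require Import measurable_realfun ring lra.

Import Order.TTheory GRing.Theory Num.Theory.
Import numFieldNormedType.Exports.

Local Open Scope classical_set_scope.
Local Open Scope ring_scope.
Local Open Scope complex_scope.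

(** The iteration is not run as a limit: the series, finite at each time, is checked to satisfy the
    integral equation, and a separate uniqueness argument makes it the only solution. The obstacle
    is regularity. Cut off to 0 on the negative axis, the constant 1 and in general the forcing jump
    at 0, while kernels of order below 1 are singular. The class of integrands must therefore allow
    a jump at 0 and still be stable under each pass; this works because convolution removes the jump
    before a delay could move it away from 0. The analysis is done with real functions on the whole
    line, where translations, reflections and Fubini need no bookkeeping of endpoints; complex
    values enter only as pairs of real ones. *)

(** * Affine changes of variables for Lebesgue measure *)

Lemma measurable_affine (R : realType) (c b : R) :
  measurable_fun [set: R] (fun x : R => c * x + b).
Proof. by apply: measurable_funD => //; exact: measurable_funM. Qed.

(** The pushforward under the affine map, scaled by [|c|], gives each []p, q]] its length, and
    Lebesgue measure is the only measure doing so. For [c < 0] the preimage is closed on the other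
    side, which does not affect its length. *)
Lemma lebesgue_measure_affine (R : realType) (c b : R) (A : set R) :
  c != 0 -> measurable A ->
  (@lebesgue_measure R A =
   `|c|%:E * lebesgue_measure ((fun x => c * x + b)%R @^-1` A))%E.
Proof.
move=> c0 mA.
have cn0 : 0 <= `|c| by [].
pose phi : measurableTypeR R -> measurableTypeR R := fun x => c * x + b.
have mphi : measurable_fun [set: measurableTypeR R] phi.
  exact: measurable_affine.
pose nu : {measure set _ -> \bar R} :=
  mscale (NngNum cn0)
    (measure_function_pushforward__canonical__measure_function_Measure
       (@lebesgue_measure R) mphi).
apply: (@lebesgue_measure_unique R nu) => // _ [[p q]] _ <-.
rewrite /nu/= /mscale/= /pushforward /=.
have [cgt0|clt0] : c > 0 \/ c < 0 by lra.
- rewrite (_ : _ @^-1` _ = `](p - b) / c, (q - b) / c]%classic); last first.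
    apply/seteqP; split => x /=;
    rewrite !in_itv/= ltr_pdivrMr// ler_pdivlMr// /phi; lra.
  rewrite !lebesgue_measure_itv/= !lte_fin ltr_pM2r ?invr_gt0// ltrD2r.
  case: ifPn => _; last by rewrite mule0.
  by rewrite -!EFinD -EFinM gtr0_norm//; congr EFin; field.
- rewrite (_ : _ @^-1` _ = `[(q - b) / c, (p - b) / c[%classic); last first.
    apply/seteqP; split => x /=;
    rewrite !in_itv/= ltr_ndivlMr// ler_ndivrMr// /phi; lra.
  rewrite !lebesgue_measure_itv/= !lte_fin ltr_nM2r ?invr_lt0// ltrD2r.
  case: ifPn => _; last by rewrite mule0.
  by rewrite -!EFinD -EFinM ltr0_norm//; congr EFin; field.
Qed.

Lemma ge0_integral_affine (R : realType) (c b : R) (g : R -> \bar R) :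
  c != 0 -> measurable_fun [set: R] g -> (forall x, 0 <= g x)%E ->
  (\int[@lebesgue_measure R]_x g x =
   `|c|%:E * \int[@lebesgue_measure R]_x g (c * x + b)%R)%E.
Proof.
move=> c0 mg g0.
have cn0 : 0 <= `|c| by [].
pose phi : measurableTypeR R -> measurableTypeR R := fun x => c * x + b.
have mphi : measurable_fun [set: measurableTypeR R] phi.
  exact: measurable_affine.
pose nu : {measure set _ -> \bar R} :=
  mscale (NngNum cn0)
    (measure_function_pushforward__canonical__measure_function_Measure
       (@lebesgue_measure R) mphi).
transitivity (\int[nu]_x g x)%E.
  apply: eq_measure_integral => A mA _.
  exact: (lebesgue_measure_affine R c b A).
rewrite ge0_integral_mscale//=; congr (_ * _)%E.
by rewrite ge0_integral_pushforward.
Qed.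

Lemma Rintegral_isometry (R : realType) (c b : R) (g : R -> R) :
  `|c| = 1 -> measurable_fun [set: R] g ->
  \int[@lebesgue_measure R]_x g x = \int[@lebesgue_measure R]_x g (c * x + b).
Proof.
move=> c1 mg; have c0 : c != 0 by rewrite -normr_eq0 c1 oner_eq0.
rewrite /Rintegral integralE [in RHS]integralE.
have mE : measurable_fun [set: R] (EFin \o g) by exact/measurable_EFinP.
rewrite (ge0_integral_affine _ c b _ c0 (measurable_funepos mE))//.
rewrite [X in (_ - X)%E](ge0_integral_affine _ c b _ c0 (measurable_funeneg mE))//.
rewrite c1 !mul1e; congr (fine (_ - _)%E); apply: eq_integral => x _;
by rewrite ?funeposE ?funenegE.
Qed.

Lemma integrable_isometry (R : realType) (c b : R) (g : R -> R) :
  `|c| = 1 ->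
  (@lebesgue_measure R).-integrable [set: R] (EFin \o g) ->
  (@lebesgue_measure R).-integrable [set: R] (EFin \o (fun x => g (c * x + b))).
Proof.
move=> c1 /integrableP[mg ig]; have c0 : c != 0 by rewrite -normr_eq0 c1 oner_eq0.
apply/integrableP; split.
  by apply: (measurableT_comp mg); exact: measurable_affine.
move: ig; rewrite (ge0_integral_affine _ c b) ?c1 ?mul1e//.
exact: measurableT_comp.
Qed.

(** * The Gamma function *)

Definition gamma_density (R : realType) (s x : R) : R :=
  if 0 < x then x `^ (s - 1) * expR (- x) else 0.

Lemma gamma_density_ge0 (R : realType) (s x : R) : 0 <= gamma_density R s x.
Proof.
rewrite /gamma_density; case: ifP => // _.
by rewrite mulr_ge0// ?powR_ge0 ?expR_ge0.
Qed.

Lemma measurable_gamma_density (R : realType) (s : R) :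
  measurable_fun [set: R] (gamma_density R s).
Proof.
apply: measurable_fun_ifT => //.
- by apply: (@measurable_fun_ltr _ _ _ _ (cst 0) id).
- apply: (@measurable_funM _ _ _ _ (fun x => x `^ (s - 1)) (fun x => expR (- x))).
    exact: measurable_powR.
  by apply: measurableT_comp => //; exact: oppr_measurable.
Qed.

(** For [s < 1] the integrand is singular at 0, so the antiderivative x^s / s is used on
    [1/(n+1), 1] only; the integrals stay below 1/s, and monotone convergence passes the bound to
    the limit. *)
Lemma integrable_powR01 (R : realType) (s : R) : 0 < s ->
  (@lebesgue_measure R).-integrable `]0, 1] (fun x => (x `^ (s - 1))%:E).
Proof.
move=> s0.
have mf : measurable_fun [set: R] (fun x : R => (x `^ (s - 1))%:E).
  by apply/measurable_EFinP; exact: measurable_powR.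
apply/integrableP; split; first exact: measurable_funTS.
under eq_integral do rewrite /= ger0_norm ?powR_ge0//.
pose F (n : nat) : set R := `[n.+1%:R^-1, 1]%classic.
have FE : `]0, 1]%classic = \bigcup_n F n.
  apply/seteqP; split => x /=.
    rewrite in_itv/= => /andP[x0 x1].
    have [n nx] := ltr_add_invr x0.
    by exists n => //; rewrite /F/= in_itv/= x1 andbT -[_^-1]add0r ltW.
  move=> [n _]; rewrite /F/= !in_itv/= => /andP[nx ->]; rewrite andbT.
  by apply: lt_le_trans nx; rewrite invr_gt0.
rewrite FE.
have ndF : nondecreasing_seq F.
  move=> m n mn; apply/subsetPset => x; rewrite /F/= !in_itv/= => /andP[mx ->].
  rewrite andbT (le_trans _ mx)// lef_pV2 ?posrE// ler_nat ltnS//.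
have cvgF : (\int[@lebesgue_measure R]_(x in F n) (x `^ (s - 1))%:E @[n --> \oo] -->
    \int[@lebesgue_measure R]_(x in \bigcup_n F n) (x `^ (s - 1))%:E)%E.
  apply: ge0_nondecreasing_set_cvg_integral => //.
  - by move=> n; exact: measurable_itv.
  - by move=> n; exact: measurable_funTS.
  - by move=> n x _; rewrite lee_fin powR_ge0.
apply: (@le_lt_trans _ _ (s^-1)%:E); last exact: ltry.
apply: (cvge_le _ cvgF); apply: nearW => n /=.
have n0 : (0:R) < n.+1%:R^-1 by rewrite invr_gt0.
(* For n = 0 the interval is the single point 1, out of reach of the fundamental theorem. *)
have [n1|n1] := ltP (n.+1%:R^-1 : R) 1; last first.
  have -> : F n = [set 1] `&` F n.
    apply/seteqP; split => x /=; last by case.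
    move=> Fx; split=> //; apply/eqP; move: Fx; rewrite /F/= in_itv/= => /andP[a b].
    by rewrite eq_le b (le_trans n1).
  rewrite (_ : _ `&` _ = [set 1]) ?integral_set1 ?lee_fin ?invr_ge0 ?ltW//.
  apply/seteqP; split => x /= ; first by case.
  move=> ->; split => //; rewrite /F/= in_itv/= lexx andbT.
  by rewrite invf_le1// ler1n.
rewrite (@continuous_FTC2 R (fun x => x `^ (s - 1)) (fun x => s^-1 * x `^ s) _ _ n1).
- rewrite powR1 mulr1 -EFinB lee_fin lerBlDr lerDl mulr_ge0// ?powR_ge0// invr_ge0 ltW//.
- apply: derivable_within_continuous => x; rewrite in_itv/= => /andP[nx _].
  by apply: derivable_powR; rewrite in_itv/= andbT (lt_le_trans n0).
- have dF (x : R) : 0 < x -> derivable (fun x => s^-1 * x `^ s) x 1.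
    move=> x0; apply: derivableM => //.
    by apply: derivable_powR; rewrite in_itv/= andbT.
  have cF (x : R) : 0 < x -> {for x, continuous (fun x => s^-1 * x `^ s)}.
    by move=> x0; apply: differentiable_continuous; apply/derivable1_diffP/dF.
  split.
  + move=> x; rewrite in_itv/= => /andP[nx _]; apply: dF; exact: lt_trans nx.
  + by apply: cvg_at_right_filter; exact: cF.
  + by apply: cvg_at_left_filter; exact: cF.
- move=> x; rewrite in_itv/= => /andP[nx _].
  have x0 : 0 < x by exact: lt_trans nx.
  rewrite derive1E deriveM//; last first.
    by apply: derivable_powR; rewrite in_itv/= andbT.
  rewrite derive_cst scaler0 addr0 -derive1E powR_derive1 ?in_itv/= ?andbT//.
  by rewrite /GRing.scale/= mulrA mulVf ?mul1r ?gt_eqF.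
Qed.

(** With p = |s| + 1, the inequality ln v < v at v = x/(2p) gives s ln x <= p ln x <= p ln(2p) + x/2
    for x >= 1. *)
Lemma powR_le_expR_half (R : realType) (s : R) :
  exists C : R, 0 <= C /\ forall x, 1 <= x -> x `^ s <= C * expR (2^-1 * x).
Proof.
pose p := `|s| + 1.
have p0 : 0 < p by rewrite /p; have := normr_ge0 s; lra.
exists (expR (p * (ln (2 * p)))); split; first exact: expR_ge0.
move=> x x1; rewrite /powR gt_eqF; last lra.
rewrite -expRD ler_expR.
have lnx0 : 0 <= ln x by rewrite ln_ge0.
apply: (@le_trans _ _ (p * ln x)).
  apply: ler_wpM2r => //; rewrite /p; have := ler_norm s; lra.
have -> : ln x = ln (2 * p) + ln (x / (2 * p)).
  have p20 : 0 < 2 * p by lra.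
  rewrite -lnM ?posrE//; last by rewrite divr_gt0//; lra.
  by congr ln; field; rewrite gt_eqF.
rewrite mulrDr lerD2l.
have -> : 2^-1 * x = p * (x / (2 * p)) by field; rewrite gt_eqF.
rewrite ler_pM2l// ltW// ln_sublinear// divr_gt0//; lra.
Qed.

Lemma integrable_gamma_density (R : realType) (s : R) : 0 < s ->
  (@lebesgue_measure R).-integrable [set: R] (EFin \o gamma_density R s).
Proof.
move=> s0; have [C [C0 HC]] := powR_le_expR_half R (s - 1).
pose p : R -> R := (fun x => x `^ (s - 1)) \_ `]0, 1].
(* The majorant: the power near 0, and beyond 1 half of the decay of exp(-x). The factor 2 cancels
   the normalisation 1/2 of the exponential density. *)
pose h (x : R) := p x + (2 * C) * exponential_pdf (2^-1) x.
have ih : (@lebesgue_measure R).-integrable [set: R] (EFin \o h).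
  have -> : EFin \o h =
    ((EFin \o p) \+
     (fun x => (2 * C)%:E * (exponential_pdf (2^-1) x)%:E))%E by [].
  apply: integrableD => //.
    rewrite /p -restrict_EFin.
    by apply: (integrable_mkcond _ _).1 => //; exact: integrable_powR01.
  apply: integrableZl => //.
  by apply: integrable_exponential_pdf => //; rewrite invr_gt0.
apply: le_integrable ih => //.
  by apply/measurable_EFinP; exact: measurable_gamma_density.
move=> x _ /=; rewrite lee_fin ger0_norm ?gamma_density_ge0//.
apply: le_trans (ler_norm _).
rewrite /h /p /gamma_density; case: ifPn => x0; last first.
  apply: addr_ge0; last by rewrite mulr_ge0 ?exponential_pdf_ge0// mulr_ge0.
  by rewrite patchE; case: ifP => // _; exact: powR_ge0.
rewrite exponential_pdfE; last exact: ltW.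
rewrite patchE; case: ifPn => x1.
  apply: (@le_trans _ _ (x `^ (s - 1))).
    by rewrite ler_piMr ?powR_ge0// expR_le1 oppr_le0 ltW.
  by rewrite lerDl mulr_ge0// ?mulr_ge0// ?expR_ge0.
rewrite add0r.
have {}x1 : 1 <= x.
  move: x1; rewrite leNgt; apply: contraNN => x1.
  by rewrite inE/= in_itv/= x0 ltW.
have := HC x x1 => /(ler_wpM2r (expR_ge0 (- x))) /le_trans; apply.
rewrite le_eqVlt; apply/orP; left; apply/eqP.
have -> : expR (- 2^-1 * x) = expR (2^-1 * x) * expR (- x).
  by rewrite -expRD; congr expR; lra.
by field.
Qed.

Lemma integral_gamma_density (R : realType) (s : R) : 0 < s ->
  (\int[@lebesgue_measure R]_x (gamma_density R s x)%:E = (Gamma s)%:E)%E.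
Proof.
move=> s0; rewrite -[LHS]fineK; last first.
  by apply: integrable_fin_num => //; exact: integrable_gamma_density.
rewrite /Gamma Rintegral_mkcond /Rintegral; congr EFin; congr fine.
apply: eq_integral => x _; rewrite patchE /gamma_density; congr EFin.
by rewrite mem_setE in_itv/= andbT.
Qed.

(** A zero integral would force the nonnegative density to vanish almost everywhere, but it is
    positive on []0, 1[], a set of measure 1. *)
Lemma Gamma_gt0 (R : realType) (s : R) : 0 < s -> 0 < Gamma s.
Proof.
move=> s0; rewrite -lte_fin -integral_gamma_density// lt0e.
rewrite integral_ge0 ?andbT => [|x _]; last by rewrite lee_fin gamma_density_ge0.
apply/eqP => int0.
have mg : measurable_fun [set: R] (EFin \o gamma_density R s).
  by apply/measurable_EFinP; exact: measurable_gamma_density.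
have /(ae_eq_integral_abs (@lebesgue_measure R) measurableT mg) : 
    (\int[@lebesgue_measure R]_(x in setT) `|(EFin \o gamma_density R s) x| = 0)%E.
  rewrite -[RHS]int0; apply: eq_integral => x _ /=.
  by rewrite ger0_norm// gamma_density_ge0.
move=> -[N [mN N0 subN]].
have : ((@lebesgue_measure R) `]0%R, 1%R[%classic <= lebesgue_measure N)%E.
  apply: le_measure; rewrite ?inE//; apply: subset_trans subN => x /=.
  rewrite in_itv/= => /andP[x0 x1] /(_ I)[].
  rewrite /gamma_density x0 => /eqP.
  by rewrite mulf_eq0 !gt_eqF ?expR_gt0 ?powR_gt0.
rewrite [X in (_ <= X)%E]N0 lebesgue_measure_itv/= lte_fin ltr01 oppr0 addr0.
by rewrite lee_fin ler10.
Qed.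

Lemma Gamma1 (R : realType) : Gamma 1 = 1 :> R.
Proof.
apply: EFin_inj; rewrite -integral_gamma_density// -(@integral_exponential_pdf R 1)//.
have mexp (A : set R) : measurable_fun A (fun x : R => (expR (- x))%:E).
  by apply/measurable_EFinP; apply: measurableT_comp => //; exact: oppr_measurable.
transitivity (\int[@lebesgue_measure R]_(x in `]0%R, +oo[) (expR (- x))%:E)%E.
  rewrite [RHS]integral_mkcond; apply: eq_integral => x _.
  rewrite patchE mem_setE in_itv/= andbT /gamma_density.
  by case: ifP => // _; rewrite subrr powRr0 mul1r.
rewrite integral_itv_obnd_cbnd// integral_mkcond; apply: eq_integral => x _.
rewrite /exponential_pdf !patchE; case: ifP => // _.
by rewrite mul1r mulN1r.
Qed.

(** * Riemann-Liouville kernels *)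

(* The value 0 on the half-line x <= 0 turns J_0^b into a convolution on R. *)
Definition RL_kernel (R : realType) (b x : R) : R :=
  if 0 < x then x `^ (b - 1) / Gamma b else 0.

Section kernel.
Variable R : realType.
Implicit Types a b x u : R.
Local Notation mu := (@lebesgue_measure R).
Local Notation k := (RL_kernel R).

Lemma RL_kernel_ge0 b x : 0 < b -> 0 <= k b x.
Proof.
move=> b0; rewrite /RL_kernel; case: ifP => // _.
by rewrite divr_ge0// ?powR_ge0// ltW// Gamma_gt0.
Qed.

Lemma RL_kernel_le0 b x : x <= 0 -> k b x = 0.
Proof. by rewrite /RL_kernel leNgt => /negbTE ->. Qed.

Lemma RL_kernel_gt0 b x : 0 < x -> k b x = x `^ (b - 1) / Gamma b.
Proof. by rewrite /RL_kernel => ->. Qed.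

Lemma RL_kernel1 x : 0 < x -> k 1 x = 1.
Proof. by move=> x0; rewrite RL_kernel_gt0// subrr powRr0 Gamma1 divr1. Qed.

Lemma measurable_RL_kernel b : measurable_fun [set: R] (k b).
Proof.
apply: measurable_fun_ifT => //.
- by apply: (@measurable_fun_ltr _ _ _ _ (cst 0) id).
- apply: (@measurable_funM _ _ _ _ (fun x => x `^ (b - 1)) (cst (Gamma b)^-1)) => //.
Qed.

Lemma RL_kernelZ b u x : 0 < u -> k b (u * x) = u `^ (b - 1) * k b x.
Proof.
move=> u0; rewrite /RL_kernel pmulr_rgt0//; case: ifPn => x0; last by rewrite mulr0.
by rewrite powRM ?mulrA// ltW.
Qed.

Lemma RL_kernel_expR b x :
  k b x * expR (- x) = (Gamma b)^-1 * gamma_density R b x.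
Proof.
rewrite /RL_kernel /gamma_density; case: ifP => _; last by rewrite mul0r mulr0.
by rewrite -mulrA mulrCA.
Qed.

Lemma integrable_RL_kernel_expR b : 0 < b ->
  mu.-integrable [set: R] (EFin \o (fun x => k b x * expR (- x))).
Proof.
move=> b0; have -> : EFin \o (fun x => k b x * expR (- x)) =
    (fun x => (Gamma b)^-1%:E * (gamma_density R b x)%:E)%E.
  by apply/funext => x /=; rewrite RL_kernel_expR.
by apply: integrableZl => //; exact: integrable_gamma_density.
Qed.

(** The Laplace transform of the kernel at 1. Its value does not depend on the order, which is what
    determines the constant of the Beta integral. *)
Lemma integral_RL_kernel_expR b : 0 < b ->
  (\int[mu]_x (k b x * expR (- x))%:E = 1)%E.
Proof.
move=> b0; under eq_integral do rewrite RL_kernel_expR EFinM.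
rewrite integralZl//; last exact: integrable_gamma_density.
by rewrite integral_gamma_density// -EFinM mulVf// gt_eqF// Gamma_gt0.
Qed.

Lemma measurable_RL_kernel_sub b u : measurable_fun [set: R] (fun x => k b (u - x)).
Proof.
apply: measurableT_comp; first exact: measurable_RL_kernel.
exact: measurable_funB.
Qed.

Lemma measurable_RL_kernel_sub2 b :
  measurable_fun [set: R * R] (fun z => k b (z.1 - z.2)).
Proof.
apply: measurableT_comp; first exact: measurable_RL_kernel.
apply: measurable_funB; [exact: measurable_fst|exact: measurable_snd].
Qed.

(* Both sides are homogeneous of degree a + b - 1 in u, so they agree up to a
   constant; integrating against exp(-u) (Tonelli) shows that it is 1. *)
Lemma RL_kernel_conv a b u : 0 < a -> 0 < b ->
  (\int[mu]_x (k a (u - x) * k b x)%:E = (k (a + b) u)%:E)%E.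
Proof.
move=> a0 b0; have ab0 : 0 < a + b by rewrite addr_gt0.
have G0 := Gamma_gt0 R (a + b) ab0.
have mprod v : measurable_fun [set: R] (fun x => (k a (v - x) * k b x)%:E).
  apply/measurable_EFinP; apply: measurable_funM.
    exact: measurable_RL_kernel_sub.
  exact: measurable_RL_kernel.
(* The value at u = 1, possibly infinite at this stage; hence the computation in extended reals,
   with nonnegativity alone. *)
pose C := (\int[mu]_x (k a (1 - x) * k b x)%:E)%E.
have C0 : (0 <= C)%E.
  by apply: integral_ge0 => x _; rewrite lee_fin mulr_ge0 ?RL_kernel_ge0.
have scale v : (\int[mu]_x (k a (v - x) * k b x)%:E =
    (Gamma (a + b) * k (a + b) v)%:E * C)%E.
  (* For v <= 0 one of the two factors always vanishes. For v > 0 the substitution of v x for x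
     extracts v v^(a-1) v^(b-1) = v^(a+b-1). *)
  have [v0|v0] := leP v 0.
    rewrite RL_kernel_le0// mulr0 mul0e; apply: integral0_eq => x _.
    have [x0|x0] := leP x 0; first by rewrite [k b x]RL_kernel_le0// mulr0.
    by rewrite RL_kernel_le0 ?mul0r//; lra.
  rewrite (ge0_integral_affine _ v 0 _ (lt0r_neq0 v0) (mprod v)); last first.
    by move=> x; rewrite lee_fin mulr_ge0 ?RL_kernel_ge0.
  rewrite (gtr0_norm v0).
  under eq_integral => x _.
    rewrite addr0 (_ : v - v * x = v * (1 - x)); last lra.
    rewrite !RL_kernelZ// mulrACA EFinM.
    over.
  rewrite ge0_integralZl//; last 3 first.
    exact: mprod.
    by move=> x _; rewrite lee_fin mulr_ge0 ?RL_kernel_ge0.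
    by rewrite lee_fin mulr_ge0 ?powR_ge0.
  rewrite muleA -EFinM; congr (_%:E * _)%E.
  rewrite RL_kernel_gt0// [RHS]mulrCA divff ?gt_eqF// mulr1 mulrA mulr_powRB1//; last first.
    exact: ltW.
  by rewrite -powRD ?addrA// (gt_eqF v0) implybT.
suff GC1 : ((Gamma (a + b))%:E * C = 1)%E.
  by rewrite scale mulrC EFinM -muleA GC1 mule1.
have mF : measurable_fun [set: R * R]
    (fun z => (expR (- z.1) * (k a (z.1 - z.2) * k b z.2))%:E).
  apply/measurable_EFinP; apply: measurable_funM.
    apply: measurableT_comp => //; apply: measurableT_comp; first exact: oppr_measurable.
    exact: measurable_fst.
  apply: measurable_funM; first exact: measurable_RL_kernel_sub2.
  apply: measurableT_comp; [exact: measurable_RL_kernel|exact: measurable_snd].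
have F0 z : (0 <= (expR (- z.1) * (k a (z.1 - z.2) * k b z.2))%:E)%E.
  by rewrite lee_fin !mulr_ge0 ?expR_ge0 ?RL_kernel_ge0.
(* Integrating in y first, the scaling identity leaves the Laplace transform of the kernel of order
   a + b. *)
have HL : (\int[mu]_x \int[mu]_y (expR (- x) * (k a (x - y) * k b y))%:E =
    (Gamma (a + b))%:E * C)%E.
  under eq_integral => x _.
    under eq_integral => y _ do rewrite EFinM.
    rewrite ge0_integralZl ?lee_fin ?expR_ge0//; last 2 first.
      exact: mprod.
      by move=> y _; rewrite lee_fin mulr_ge0 ?RL_kernel_ge0.
    rewrite scale muleA -EFinM mulrCA EFinM -muleA [(expR _ * _)%R]mulrC.
    rewrite muleCA.
    over.
  rewrite ge0_integralZr//; last 3 first.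
  - by case/integrableP : (integrable_RL_kernel_expR _ ab0).
  - by move=> x _; rewrite lee_fin mulr_ge0 ?RL_kernel_ge0 ?expR_ge0.
  - by rewrite mule_ge0// lee_fin ltW.
  by rewrite (integral_RL_kernel_expR _ ab0) mul1e.
apply: etrans (esym HL) _.
apply: etrans (fubini_tonelli (m1 := mu) (m2 := mu) _ mF F0) _.
rewrite -(integral_RL_kernel_expR b b0); apply: eq_integral => y _.
(* In the other order, replacing x by x + y factors the exponential, and both Laplace transforms
   equal 1. *)
rewrite (ge0_integral_affine _ 1 y _ (oner_neq0 _)); last 2 first.
- exact: (measurableT_comp mF (pair2_measurable y)).
- by move=> x; exact: (F0 (x, y)).
rewrite normr1 mul1e.
under eq_integral => x _.
  rewrite mul1r addrK opprD expRD.
  rewrite (_ : _ * _ = k b y * expR (- y) * (k a x * expR (- x))); last by ring.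
  rewrite EFinM.
  over.
rewrite ge0_integralZl//; last 3 first.
- by case/integrableP : (integrable_RL_kernel_expR _ a0).
- by move=> x _; rewrite lee_fin mulr_ge0 ?RL_kernel_ge0 ?expR_ge0.
- by rewrite lee_fin mulr_ge0 ?RL_kernel_ge0 ?expR_ge0.
by rewrite (integral_RL_kernel_expR _ a0) mule1.
Qed.
End kernel.

(** * Convolution with causal functions *)

(* RL_kernel R 1 is the indicator function of ]0, +oo[: a causal function is
   continuous except for a possible jump at 0, and vanishes on ]-oo, 0]. *)
Definition causal (R : realType) (U : R -> R) : Prop :=
  exists2 F : R -> R, continuous F & forall x, U x = F x * RL_kernel R 1 x.

Definition RL_conv (R : realType) (b : R) (U : R -> R) (t : R) : R :=
  \int[@lebesgue_measure R]_x (RL_kernel R b (t - x) * U x).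

Section conv.
Variable R : realType.
Implicit Types (a b x c t : R) (U V : R -> R).
Local Notation mu := (@lebesgue_measure R).
Local Notation k := (RL_kernel R).

Lemma continuous_subr c : continuous (fun x : R => x - c).
Proof. by move=> x; apply: cvgB; [exact: cvg_id|exact: cvg_cst]. Qed.

Lemma causal_le0 U x : causal R U -> x <= 0 -> U x = 0.
Proof. by move=> [F _ ->] x0; rewrite RL_kernel_le0// mulr0. Qed.

Lemma measurable_causal U : causal R U -> measurable_fun [set: R] U.
Proof.
move=> [F cF UE]; rewrite (_ : U = (fun x => F x * k 1 x)); last exact/funext.
apply: measurable_funM; last exact: measurable_RL_kernel.
exact: continuous_measurable_fun.
Qed.

(** The jump does no harm, since the factor [F] is continuous up to 0. The compact interval ends at
    [|t|], so that it is nonempty for negative t too. *)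
Lemma causal_bounded U t : causal R U ->
  exists2 M, 0 <= M & forall x, x <= t -> `|U x| <= M.
Proof.
move=> [F cF UE].
have [c _ Fc] : exists2 c, c \in `[0, `|t|]%R &
    forall x, x \in `[0, `|t|]%R -> `|F x| <= `|F c|.
  apply: (@EVT_max R (fun x => `|F x|)) => //.
  apply: continuous_subspaceT => x; apply: continuous_comp; first exact: cF.
  exact: norm_continuous.
exists `|F c| => // x xt; rewrite UE.
have [x0|x0] := leP x 0; first by rewrite RL_kernel_le0// mulr0 normr0.
by rewrite RL_kernel1// mulr1 Fc// in_itv/= ltW//= (le_trans xt)// ?ler_norm.
Qed.

Lemma causalP U : continuous U -> (forall x, x <= 0 -> U x = 0) -> causal R U.
Proof.
move=> cU U0; exists U => // x.
by have [x0|x0] := leP x 0; [rewrite U0// mul0r|rewrite RL_kernel1// mulr1].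
Qed.

Lemma causal_cst c : causal R (fun x => c * k 1 x).
Proof. by exists (cst c) => //; exact: cst_continuous. Qed.

Lemma causal_kernel1 : causal R (k 1).
Proof. by exists (cst 1) => [|x]; [exact: cst_continuous|rewrite mul1r]. Qed.

Lemma causal0 : causal R (fun=> 0).
Proof. by exists (cst 0) => [|x]; [exact: cst_continuous|rewrite mul0r]. Qed.

Lemma causalD U V : causal R U -> causal R V -> causal R (fun x => U x + V x).
Proof.
move=> [F cF UE] [G cG VE]; exists (fun x => F x + G x).
  by move=> x; apply: continuousD; [exact: cF|exact: cG].
by move=> x; rewrite UE VE mulrDl.
Qed.

Lemma causalZ c U : causal R U -> causal R (fun x => c * U x).
Proof.
move=> [F cF UE]; exists (fun x => c * F x); last by move=> x; rewrite UE mulrA.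
by move=> x; apply: continuousM; [exact: cst_continuous|exact: cF].
Qed.

Lemma integrable_RL_kernel_expR_sub b t : 0 < b ->
  mu.-integrable [set: R] (EFin \o (fun x => k b (t - x) * expR (- (t - x)))).
Proof.
move=> b0.
have /(integrable_isometry _ (-1) t) := integrable_RL_kernel_expR R _ b0.
rewrite normrN normr1 => /(_ erefl).
rewrite (_ : (fun x => _) = (fun x => k b (t - x) * expR (- (t - x))))//.
by apply/funext => x; rewrite mulN1r addrC.
Qed.

Lemma integrable_conv b U t : 0 < b -> causal R U ->
  mu.-integrable [set: R] (EFin \o (fun x => k b (t - x) * U x)).
Proof.
move=> b0 cU; have [M M0 UM] := causal_bounded U t cU.
have := integrable_RL_kernel_expR_sub _ t b0.
(* The kernel is integrable on the whole line only with an exponential weight. The factor exp(t)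
   makes the weight exp(t) exp(-(t - x)) = exp(x) at least 1 where U lives. *)
move=> /(integrableZl measurableT (M * expR t)); apply: le_integrable => //.
  apply/measurable_EFinP; apply: measurable_funM; last exact: measurable_causal.
  exact: measurable_RL_kernel_sub.
move=> x _; rewrite /= lee_fin.
have kt := RL_kernel_ge0 R b (t - x) b0.
rewrite [leRHS]ger0_norm ?mulr_ge0 ?expR_ge0// normrM ger0_norm//.
have [x0|x0] := leP x 0.
  by rewrite (causal_le0 U)// normr0 mulr0 !mulr_ge0 ?expR_ge0.
have [tx|tx] := leP t x.
  by rewrite RL_kernel_le0 ?mul0r ?mulr0// subr_le0.
rewrite (_ : M * expR t * _ =
  k b (t - x) * (M * (expR t * expR (- (t - x))))); last by ring.
rewrite ler_wpM2l// -expRD (le_trans (UM x (ltW tx)))// ler_peMr//.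
rewrite -(expR0 R) ler_expR; lra.
Qed.

Lemma RL_convD b U V t : 0 < b -> causal R U -> causal R V ->
  RL_conv R b (fun x => U x + V x) t = RL_conv R b U t + RL_conv R b V t.
Proof.
move=> b0 cU cV; rewrite /RL_conv -RintegralD//; try exact: integrable_conv.
by apply: eq_Rintegral => x _; rewrite mulrDr.
Qed.

Lemma RL_convZ b c U t : 0 < b -> causal R U ->
  RL_conv R b (fun x => c * U x) t = c * RL_conv R b U t.
Proof.
move=> b0 cU; rewrite /RL_conv -RintegralZl//; try exact: integrable_conv.
by apply: eq_Rintegral => x _; rewrite mulrCA.
Qed.

Lemma RL_conv_le0 b U t : causal R U -> t <= 0 -> RL_conv R b U t = 0.
Proof.
move=> cU t0; rewrite /RL_conv (@eq_Rintegral _ _ _ _ _ (cst 0)).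
  by rewrite Rintegral_cst// mul0r.
move=> x _ /=; have [x0|x0] := leP x 0; first by rewrite (causal_le0 U)// mulr0.
rewrite RL_kernel_le0 ?mul0r//; lra.
Qed.

Lemma measurable_conv b U t : causal R U ->
  measurable_fun [set: R] (fun x => k b (t - x) * U x).
Proof.
move=> cU; apply: measurable_funM; last exact: measurable_causal.
exact: measurable_RL_kernel_sub.
Qed.

(** In this form the singularity of the kernel stays at 0 while t varies, as dominated convergence
    needs. *)
Lemma RL_convC b U t : causal R U ->
  RL_conv R b U t = \int[mu]_x (k b x * U (t - x)).
Proof.
move=> cU; rewrite /RL_conv (Rintegral_isometry _ (-1) t); last 2 first.
- by rewrite normrN normr1.
- exact: measurable_conv.
apply: eq_Rintegral => x _; congr (k b _ * U _); lra.
Qed.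

Lemma RL_conv_shift b U c t : causal R U ->
  RL_conv R b (fun x => U (x - c)) t = RL_conv R b U (t - c).
Proof.
move=> cU; rewrite /RL_conv (Rintegral_isometry _ 1 c); last 2 first.
- by rewrite normr1.
- apply: measurable_funM; first exact: measurable_RL_kernel_sub.
  apply: measurableT_comp; first exact: measurable_causal.
  exact: measurable_funB.
apply: eq_Rintegral => x _; congr (k b _ * U _); lra.
Qed.

Lemma RL_conv_kernel1 b t : 0 < b -> RL_conv R b (k 1) t = k (b + 1) t.
Proof. by move=> b0; rewrite /RL_conv /Rintegral RL_kernel_conv. Qed.

(** The exponent is now b > 0, so x^b tends to 0 at 0 from the right and joins the zero half-line
    continuously. *)
Lemma continuous_kernelS b : 0 < b -> continuous (k (b + 1)).
Proof.
move=> b0 x; have [x0|x0|x0] := ltgtP x 0.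
- apply: cvg_near_cst; near=> y.
  rewrite !RL_kernel_le0// ltW//; near: y; exact: lt_nbhsl.
- apply: (@cvg_trans _ (((fun y => (Gamma (b + 1))^-1 * y `^ b) y) @[y --> x])).
    apply: near_eq_cvg; near=> y.
    rewrite RL_kernel_gt0 ?addrK 1?mulrC//; near: y; exact: lt_nbhsr.
  rewrite RL_kernel_gt0// addrK [_ / _]mulrC.
  apply: (@continuousM _ _ (cst _) (fun y => y `^ b)); first exact: cst_continuous.
  apply: differentiable_continuous; apply/derivable1_diffP.
  by apply: derivable_powR; rewrite in_itv/= x0.
- rewrite x0; apply/left_right_continuousP; rewrite [k _ 0]RL_kernel_le0//; split.
    by apply: cvg_near_cst; near=> y; rewrite RL_kernel_le0.
  apply: (@cvg_trans _ (((fun y => (Gamma (b + 1))^-1 * y `^ b) y) @[y --> 0^'+])).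
    by apply: near_eq_cvg; near=> y; rewrite RL_kernel_gt0 ?addrK 1?mulrC.
  have : (Gamma (b + 1))^-1 * y `^ b @[y --> 0^'+] --> (Gamma (b + 1))^-1 * 0.
    by apply: cvgM; [exact: cvg_cst|exact: powR_cvg0].
  by rewrite mulr0.
Unshelve. all: by end_near. Qed.

(** Dominated convergence in the reflected form. Continuity of V is essential to it: a jump would
    occur at t = x, so no x in the range of t would have a continuous integrand. *)
Lemma continuous_conv0 b V : 0 < b -> causal R V -> continuous V ->
  continuous (RL_conv R b V).
Proof.
move=> b0 caV cV s.
rewrite (_ : RL_conv R b V = fun t => \int[mu]_x (k b x * V (t - x))); last first.
  by apply/funext => t; exact: RL_convC.
have [M M0 VM] := causal_bounded V (s + 1) caV.
apply: (@continuity_under_integral R _ _ mu (fun t x => k b x * V (t - x)) setT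
   (* For t < s + 1, V (t - x) vanishes once x > s + 1, and before that exp(s + 1 - x) >= 1. *)
   measurableT (s - 1) (s + 1) _ _ (fun x => M * expR (s + 1) * (k b x * expR (- x)))).
- move=> t _.
  have := integrable_conv b V t b0 caV.
  move=> /(integrable_isometry _ (-1) t); rewrite normrN normr1 => /(_ erefl).
  rewrite (_ : (fun x => _) = (fun x => k b x * V (t - x)))//.
  by apply/funext => x; congr (k b _ * V _); lra.
- apply: aeW => x _ t _.
  apply: cvgM; first exact: cvg_cst.
  exact: (continuous_comp (continuous_subr x t) (cV (t - x))).
- have := integrable_RL_kernel_expR R b b0.
  exact: (integrableZl measurableT (M * expR (s + 1))).
- move=> t; rewrite /= in_itv/= => /andP[_ ts]; apply: aeW => x _.
  rewrite normrM (ger0_norm (RL_kernel_ge0 _ _ _ b0)).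
  rewrite (_ : M * _ * _ = k b x * (M * (expR (s + 1) * expR (- x)))); last by ring.
  have [x0|x0] := leP x 0; first by rewrite RL_kernel_le0// !mul0r.
  rewrite ler_wpM2l ?RL_kernel_ge0// -expRD.
  have [xs|xs] := leP x (s + 1).
    have tx : t - x <= s + 1 by lra.
    apply: le_trans (VM _ tx) _.
    by rewrite ler_peMr//; have := expR_ge1Dx (s + 1 - x); lra.
  by rewrite (causal_le0 V)// ?normr0 ?mulr_ge0 ?expR_ge0//; lra.
- rewrite inE/= in_itv/=; lra.
Qed.

(* The jump of U at 0 is split off as a multiple of RL_kernel R 1, whose
   convolution is explicit; the rest is continuous on R. *)
Lemma continuous_conv b U : 0 < b -> causal R U -> continuous (RL_conv R b U).
Proof.
move=> b0 [F cF UE].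
(* [F] is frozen at its value at 0 on the negative axis; after subtracting this value, the result is
   both continuous and causal. *)
pose V x := F (Num.max x 0) - F 0.
have cV : continuous V.
  move=> x; apply: continuousB; last exact: cst_continuous.
  apply: continuous_comp; last exact: cF.
  by apply: continuous_max => //; exact: cst_continuous.
have V0 x : x <= 0 -> V x = 0 by move=> x0; rewrite /V max_r// subrr.
have caV := causalP _ cV V0.
rewrite (_ : RL_conv R b U = fun t => F 0 * k (b + 1) t + RL_conv R b V t); last first.
  apply/funext => t; rewrite -RL_conv_kernel1// -RL_convZ//; last exact: causal_kernel1.
  rewrite -RL_convD//; last exact: causal_cst.
  congr RL_conv; apply/funext => x; rewrite UE.
  have [x0|x0] := leP x 0; first by rewrite V0// RL_kernel_le0// !mulr0 addr0.
  by rewrite RL_kernel1// !mulr1 /V max_l ?ltW// addrC subrK.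
move=> t; apply: cvgD; last exact: continuous_conv0.
by apply: cvgM; [exact: cvg_cst|exact: continuous_kernelS].
Qed.

(** Delaying U itself could put a jump at c and leave the class; its convolution is continuous, so
    it can be delayed. This stability permits the iteration. *)
Lemma causal_conv_shift b U c : 0 < b -> 0 <= c -> causal R U ->
  causal R (fun x => RL_conv R b U (x - c)).
Proof.
move=> b0 c0 cU; apply: causalP => [x|x x0].
  exact: (continuous_comp (continuous_subr c x) (continuous_conv b U b0 cU (x - c))).
by rewrite RL_conv_le0//; lra.
Qed.

Lemma causal_conv b U : 0 < b -> causal R U -> causal R (RL_conv R b U).
Proof.
move=> b0 cU; have := causal_conv_shift b U 0 b0 (lexx _) cU.
by congr causal; apply/funext => x; rewrite subr0.
Qed.

(** The inner integral of the Fubini argument: the Beta integral translated by y. The constant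
    stands for [U y] in the value and for its absolute value in the integrability check. *)
Lemma integral_RL_kernel2 a b t y c : 0 < a -> 0 < b ->
  (\int[mu]_x (k a (t - x) * k b (x - y) * c)%:E = (k (a + b) (t - y) * c)%:E)%E.
Proof.
move=> a0 b0.
have mf : measurable_fun [set: R] (fun x => (k a (t - x) * k b (x - y))%:E).
  apply/measurable_EFinP; apply: measurable_funM; first exact: measurable_RL_kernel_sub.
  apply: measurableT_comp; first exact: measurable_RL_kernel.
  exact: measurable_funB.
have f0 x : (0 <= (k a (t - x) * k b (x - y))%:E)%E.
  by rewrite lee_fin mulr_ge0 ?RL_kernel_ge0.
have fE : (\int[mu]_x (k a (t - x) * k b (x - y))%:E = (k (a + b) (t - y))%:E)%E.
  rewrite (ge0_integral_affine _ 1 y _ (oner_neq0 _) mf f0) normr1 mul1e -RL_kernel_conv//.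
  by apply: eq_integral => x _; congr (k a _ * k b _)%:E; lra.
under eq_integral do rewrite EFinM.
rewrite integralZr//; last first.
  apply/integrableP; split => //.
  under eq_integral do rewrite gee0_abs//.
  by rewrite fE ltry.
by rewrite fE.
Qed.

Lemma RL_conv_conv a b U t : 0 < a -> 0 < b -> causal R U ->
  RL_conv R a (RL_conv R b U) t = RL_conv R (a + b) U t.
Proof.
move=> a0 b0 cU; have ab0 : 0 < a + b by rewrite addr_gt0.
pose f (z : R * R) := (k a (t - z.1) * k b (z.1 - z.2) * U z.2)%:E.
have mf : measurable_fun [set: R * R] f.
  apply/measurable_EFinP; apply: measurable_funM; last first.
    apply: measurableT_comp; [exact: measurable_causal|exact: measurable_snd].
  apply: measurable_funM; last exact: measurable_RL_kernel_sub2.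
  exact: (measurableT_comp (measurable_RL_kernel_sub R a t) measurable_fst).
(* By Tonelli, the double integral of the absolute value is that of a single convolution of order a
   + b, known to be finite. *)
have intf : (mu \x mu)%E.-integrable [set: R * R] f.
  apply/integrable21ltyP => //.
  have /integrableP[_] := integrable_conv (a + b) U t ab0 cU.
  congr (_ < _)%E; apply: eq_integral => y _; rewrite /=.
  rewrite [in LHS]normrM.
  rewrite (ger0_norm (RL_kernel_ge0 _ _ _ ab0)) -integral_RL_kernel2//.
  apply: eq_integral => x _ /=; rewrite !normrM.
  by rewrite !(ger0_norm (RL_kernel_ge0 _ _ _ _)).
have := Fubini intf; rewrite /f/= => fub.
rewrite /RL_conv /Rintegral; congr fine.
under [RHS]eq_integral do rewrite -integral_RL_kernel2//.
rewrite -fub; apply: eq_integral => x _.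
under [RHS]eq_integral do rewrite -mulrA EFinM.
have ix := integrable_conv b U x b0 cU.
rewrite integralZl// EFinM; congr (_ * _)%E.
by rewrite fineK//; exact: integrable_fin_num.
Qed.
End conv.

(** Supplies the globally continuous factor that [causal] asks for, from a function controlled on
    the half-line only. *)
Lemma continuous_max0 (R : realType) (f : R -> R) :
  {within `[0, +oo[, continuous f} -> continuous (fun x : R => f (Num.max x 0)).
Proof.
move=> /subspace_continuousP cf x.
have max0 y : `[0, +oo[%classic (Num.max y 0 : R).
  by rewrite /= in_itv/= andbT le_max lexx orbT.
have cg : {for x, continuous (fun y : R => Num.max y 0)}.
  by apply: continuous_max => //; exact: cst_continuous.
apply: (cvg_comp (fun y => Num.max y 0) f _ (cf _ (max0 x))) => P.
rewrite /within/= => /cg; rewrite !nbhs_simpl/=.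
by apply: filterS => y; apply; exact: max0.
Qed.

(** * From real convolutions back to complex Riemann-Liouville integrals *)

Section RL_integral.
Variable R : realType.
Implicit Types (b t : R) (h U V : R -> R) (u : R -> R[i]).
Local Notation mu := (@lebesgue_measure R).
Local Notation k := (RL_kernel R).

(** The integrands can differ only at the endpoints, which are null: at 0, where U vanishes but u
    need not, and at t, where for b = 1 the power 0^0 is 1 but the kernel is 0. *)
Lemma RL_convE b t U (u : R -> R) : 0 < b -> causal R U ->
  (forall r, 0 < r <= t -> u r = U r) ->
  (Gamma b)^-1 * \int[mu]_(r in `[0, t]) ((t - r) `^ (b - 1) * u r) =
  RL_conv R b U t.
Proof.
move=> b0 cU uU.
have mg (A : set R) : measurable_fun A (fun r => ((t - r) `^ (b - 1) * U r)%:E).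
  apply/measurable_funTS/measurable_EFinP; apply: measurable_funM; last exact: measurable_causal.
  apply: (measurableT_comp (@measurable_powR R (b - 1))).
  exact: measurable_funB.
have mu' : measurable_fun `]0, t] (fun r => ((t - r) `^ (b - 1) * u r)%:E).
  apply: eq_measurable_fun (mg _) => r; rewrite inE/= in_itv/= => r0.
  by rewrite uU.
have ik := integrable_conv R b U t b0 cU.
rewrite /RL_conv -[RHS](mulKf (lt0r_neq0 (Gamma_gt0 R b b0))); congr (_ * _).
rewrite -RintegralZl//.
rewrite /Rintegral -(integral_itv_obnd_cbnd mu'); congr fine.
transitivity (\int[mu]_(r in `]0%R, t]) ((t - r) `^ (b - 1) * U r)%:E)%E.
  by apply: eq_integral => r; rewrite inE/= in_itv/= => r0; rewrite uU.
rewrite -(integral_itv_bndo_bndc (mg _)) [LHS]integral_mkcond.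
apply: eq_integral => r _; rewrite patchE; case: ifPn.
  rewrite inE/= in_itv/= => /andP[r0 rt].
  rewrite RL_kernel_gt0 ?subr_gt0//; congr EFin; field.
  exact: lt0r_neq0 (Gamma_gt0 R b b0).
rewrite notin_setE/= in_itv/= => /negP; rewrite negb_and -!leNgt => /orP[r0|rt].
  by rewrite (causal_le0 _ U)// !mulr0.
by rewrite RL_kernel_le0 ?subr_le0// mul0r mulr0.
Qed.

(* [z] is the convolution with the kernel of a causal function agreeing with [u]
   on ]0, t]; this is the class of integrands on which [RL_integral] is linear. *)
Definition has_RL_conv b t u (z : R[i]) : Prop :=
  exists U V, [/\ causal R U, causal R V,
    forall r, 0 < r <= t -> u r = U r +i* V r &
    z = RL_conv R b U t +i* RL_conv R b V t].

Lemma has_RL_conv_integral b t u z : 0 < b ->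
  has_RL_conv b t u z -> RL_integral b u t = z.
Proof.
move=> b0 [U [V [cU cV uE ->]]].
rewrite /RL_integral /Cintegral.
rewrite -(RL_convE b t U (fun r => complex.Re (u r)))//; last by move=> r /uE ->.
rewrite -(RL_convE b t V (fun r => complex.Im (u r)))//; last by move=> r /uE ->.
have mulCE (c : R) (x : R[i]) :
    c%:C * x = (c * complex.Re x) +i* (c * complex.Im x).
  by case: x => x y; apply/eqP; rewrite eq_complex/= !mul0r subr0 addr0 !eqxx.
rewrite mulCE/=.
by congr (_ * _ +i* (_ * _)); apply: eq_Rintegral => r _; rewrite mulCE.
Qed.

Lemma has_RL_convD b t u1 u2 z1 z2 : 0 < b ->
  has_RL_conv b t u1 z1 -> has_RL_conv b t u2 z2 ->
  has_RL_conv b t (fun r => u1 r + u2 r) (z1 + z2).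
Proof.
move=> b0 [U1 [V1 [cU1 cV1 u1E ->]]] [U2 [V2 [cU2 cV2 u2E ->]]].
exists (fun r => U1 r + U2 r), (fun r => V1 r + V2 r); split.
- exact: causalD.
- exact: causalD.
- by move=> r rt; rewrite u1E// u2E.
- by rewrite !RL_convD.
Qed.

(** A complex factor on a real function is enough: every term of the series has this shape. *)
Lemma has_RL_convZ b t h (c : R[i]) : 0 < b -> causal R h ->
  has_RL_conv b t (fun r => c * (h r)%:C) (c * (RL_conv R b h t)%:C).
Proof.
move=> b0 ch.
have mulEC (x : R) : c * x%:C = (complex.Re c * x) +i* (complex.Im c * x).
  by case: c => p q; apply/eqP; rewrite eq_complex/= !mulr0 subr0 add0r !eqxx.
exists (fun r => complex.Re c * h r), (fun r => complex.Im c * h r); split.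
- exact: causalZ.
- exact: causalZ.
- by move=> r _; rewrite mulEC.
- by rewrite !RL_convZ// mulEC.
Qed.

Lemma has_RL_conv_sum b t (n : nat) (u : nat -> R -> R[i]) (z : nat -> R[i]) :
  0 < b -> (forall i, has_RL_conv b t (u i) (z i)) ->
  has_RL_conv b t (fun r => \sum_(0 <= i < n) u i r) (\sum_(0 <= i < n) z i).
Proof.
move=> b0 uz; elim: n => [|n IH].
  exists (fun=> 0), (fun=> 0); split; [exact: causal0|exact: causal0| |].
    by move=> r _; rewrite big_geq.
  rewrite big_geq//.
  by have := RL_convZ R b 0 _ t b0 (causal0 R); rewrite !mul0r => ->.
have := has_RL_convD _ _ _ _ _ _ b0 IH (uz n).
rewrite -big_nat_recr//=; congr has_RL_conv; apply/funext => r.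
by rewrite big_nat_recr.
Qed.

Lemma eq_has_RL_conv b t u1 u2 z : (forall r, 0 < r <= t -> u1 r = u2 r) ->
  has_RL_conv b t u1 z -> has_RL_conv b t u2 z.
Proof.
move=> u12 [U [V [cU cV uE ->]]]; exists U, V; split => // r rt.
by rewrite -u12// uE.
Qed.

Lemma eq_RL_integral b t u1 u2 : (forall r, 0 <= r <= t -> u1 r = u2 r) ->
  RL_integral b u1 t = RL_integral b u2 t.
Proof.
move=> u12; rewrite /RL_integral /Cintegral; congr (_ * (_ +i* _));
by apply: eq_Rintegral => r; rewrite inE/= in_itv/= => rt; rewrite u12.
Qed.

Lemma continuous_real_complex h : continuous h ->
  continuous ((fun x => (h x)%:C) : R -> (R[i] : numFieldType)).
Proof.
move=> ch x; apply/cvgrPdist_lt => e e0.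
(* In the order of [R[i]], a positive number has zero imaginary part. *)
have eE : e = (complex.Re e)%:C.
  by move: e0; case: e => p q; rewrite ltcE/= => /andP[/eqP -> _].
have e0' : 0 < complex.Re e by move: e0; rewrite ltcE => /andP[].
have /cvgrPdist_lt /(_ _ e0') := ch x.
apply: filterS => y; rewrite eE -rmorphB/= => hxy.
by rewrite normc_def/= expr0n/= addr0 sqrtr_sqr ltcR.
Qed.
End RL_integral.

(** * The delay equation *)

Section delay_series.
Variables (R : realType) (alpha tau y0 : R) (lambda : R[i]) (f : R -> R).
Hypotheses (alpha0 : 0 < alpha) (tau0 : 0 < tau).
Hypothesis cf : {within `[0, +oo[, continuous f}.
Implicit Types (t : R) (k n N : nat).

Let order k : R := alpha * k%:R + alpha.
Let forcing (t : R) : R := f (Num.max t 0) * RL_kernel R 1 t.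

Let A k t := RL_conv R (order k) (RL_kernel R 1) (t - k%:R * tau).
Let B k t := RL_conv R (order k) forcing (t - k%:R * tau).

Let order_gt0 k : 0 < order k.
Proof. by rewrite ltr_wpDl// mulr_ge0// ltW. Qed.

Let causal_forcing : causal R forcing.
Proof. by exists (fun t => f (Num.max t 0)) => //; exact: continuous_max0. Qed.

Let forcingE t : 0 < t -> forcing t = f t.
Proof. by move=> t_gt0; rewrite /forcing RL_kernel1// mulr1 max_l// ltW. Qed.

Definition delay_series (N : nat) (t : R) : R[i] :=
  \sum_(0 <= k < N)
    lambda ^+ k * (lambda * y0%:C * (A k t)%:C + (B k t)%:C).

Definition delay_series_solution (t : R) : R[i] :=
  y0%:C + delay_series (Num.truncn (t / tau)).+1 t.

Let A_eq0 k t : t <= k%:R * tau -> A k t = 0.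
Proof. by move=> tk; rewrite /A RL_conv_le0 ?subr_le0//; exact: causal_kernel1. Qed.

Let B_eq0 k t : t <= k%:R * tau -> B k t = 0.
Proof. by move=> tk; rewrite /B RL_conv_le0 ?subr_le0//; exact: causal_forcing. Qed.

Lemma delay_series_trunc n N t : (n <= N)%N -> t <= n%:R * tau ->
  delay_series N t = delay_series n t.
Proof.
move=> nN tn; rewrite /delay_series (big_cat_nat _ nN)//=.
rewrite [X in _ + X](_ : _ = 0) ?addr0//.
rewrite big_nat big1// => k /andP[nk _].
have tk : t <= k%:R * tau by rewrite (le_trans tn)// ler_pM2r// ler_nat.
by rewrite A_eq0// B_eq0// mulr0 addr0 mulr0.
Qed.

(** The number of terms in the solution jumps with t; here one N serves all times up to N tau,
    because the additional terms are convolutions at nonpositive times. *)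
Lemma delay_series_solutionE N t : t <= N%:R * tau ->
  delay_series_solution t = y0%:C + delay_series N t.
Proof.
move=> tN; rewrite /delay_series_solution; congr (_ + _).
have tn : t <= (Num.truncn (t / tau)).+1%:R * tau.
  by rewrite -ler_pdivrMr// ltW// truncnS_gt.
set n := (Num.truncn _).+1.
have [nN|Nn] := leqP n N.
  by rewrite (@delay_series_trunc n N).
by rewrite (@delay_series_trunc N n)// ltnW.
Qed.

Let continuous_shifted (h : R -> R) c : continuous h ->
  continuous (fun t => h (t - c)).
Proof. by move=> ch t; exact: (continuous_comp (continuous_subr R c t) (ch _)). Qed.

Let continuous_A k : continuous (A k).
Proof.
by apply: continuous_shifted; apply: continuous_conv => //; exact: causal_kernel1.
Qed.

Let continuous_B k : continuous (B k).
Proof. by apply: continuous_shifted; exact: continuous_conv. Qed.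

Lemma continuous_delay_series N :
  continuous (delay_series N : R -> (R[i] : numFieldType)).
Proof.
elim: N => [|N IH].
  rewrite (_ : delay_series 0 = cst 0); first exact: cst_continuous.
  by apply/funext => t; rewrite /delay_series big_geq.
rewrite (_ : delay_series N.+1 = fun t => delay_series N t +
    lambda ^+ N * (lambda * y0%:C * (A N t)%:C + (B N t)%:C)); last first.
  by apply/funext => t; rewrite /delay_series big_nat_recr.
move=> t; apply: (@cvgD _ (R[i] : numFieldType)); first exact: IH.
apply: (@cvgM (R[i] : numFieldType)); first exact: cvg_cst.
apply: (@cvgD _ (R[i] : numFieldType)); last first.
  exact: (continuous_real_complex _ _ (continuous_B N)).
apply: (@cvgM (R[i] : numFieldType)); first exact: cvg_cst.
exact: (continuous_real_complex _ _ (continuous_A N)).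
Qed.

Lemma continuous_delay_series_solution :
  continuous (delay_series_solution : R -> (R[i] : numFieldType)).
Proof.
move=> t; pose N := (Num.truncn (t / tau)).+1.
(* Strictness matters: the same N remains valid in a neighbourhood of t. *)
have tN : t < N%:R * tau by rewrite -ltr_pdivrMr// truncnS_gt.
rewrite /continuous_at (delay_series_solutionE _ _ (ltW tN)).
apply: (@cvg_trans _ ((fun s => y0%:C + delay_series N s) @ t)).
  apply: near_eq_cvg; near=> s.
  rewrite (delay_series_solutionE N)// ltW//; near: s; exact: lt_nbhsl.
have cD : continuous
    ((fun s => y0%:C + delay_series N s) : R -> (R[i] : numFieldType)).
  move=> s; apply: (@cvgD _ (R[i] : numFieldType)); first exact: cvg_cst.
  exact: continuous_delay_series.
exact: cD.
Unshelve. all: by end_near. Qed.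

Lemma delay_series_solution_le0 t : t <= 0 -> delay_series_solution t = y0%:C.
Proof.
move=> t0; rewrite (delay_series_solutionE 0) ?mul0r//.
by rewrite /delay_series big_geq// addr0.
Qed.

(** One pass through the equation, a delay by tau followed by J^alpha, sends term k to term k +
    1. *)
Let RL_conv_shiftS k (U : R -> R) t : causal R U ->
  RL_conv R alpha (fun r => RL_conv R (order k) U (r - tau - k%:R * tau)) t =
  RL_conv R (order k.+1) U (t - k.+1%:R * tau).
Proof.
move=> cU; rewrite [order k.+1](_ : _ = alpha + order k); last first.
  by rewrite /order -natr1; ring.
rewrite -(RL_conv_conv R alpha (order k) U _ alpha0 (order_gt0 k) cU).
rewrite -(RL_conv_shift R alpha _ _ _ (causal_conv R _ _ (order_gt0 k) cU)).
have shiftE r : r - tau - k%:R * tau = r - k.+1%:R * tau by rewrite -natr1; ring.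
apply: (f_equal (fun h => RL_conv R alpha h t)).
by apply/funext => r; rewrite shiftE.
Qed.

Lemma delay_series_integral N t : t <= N%:R * tau ->
  RL_integral alpha (fun r => lambda * delay_series_solution (r - tau) + (f r)%:C) t =
  delay_series N.+1 t.
Proof.
move=> tN; apply: has_RL_conv_integral => //.
(* The integrand for r > 0, as a finite combination of causal functions. Its first two terms produce
   term 0 of the series, and the sum produces terms 1 to N. *)
pose u (r : R) : R[i] := lambda * y0%:C * (RL_kernel R 1 r)%:C + (forcing r)%:C +
  \sum_(0 <= k < N) (lambda ^+ k.+1 * (lambda * y0%:C) * (A k (r - tau))%:C +
    lambda ^+ k.+1 * (B k (r - tau))%:C).
apply: (@eq_has_RL_conv _ _ _ u).
  move=> r /andP[r0 rt].
  have rN : r - tau <= N%:R * tau.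
    by rewrite (le_trans _ tN)// (le_trans _ rt)// gerBl ltW.
  rewrite (delay_series_solutionE _ _ rN) /u RL_kernel1// forcingE// rmorph1 mulr1.
  rewrite mulrDr -!addrA; congr (_ + _); rewrite addrC; congr (_ + _).
  rewrite /delay_series mulr_sumr; apply: eq_bigr => k _.
  by rewrite !mulrDr exprS !mulrA.
have -> : delay_series N.+1 t =
    (lambda * y0%:C * (RL_conv R alpha (RL_kernel R 1) t)%:C +
     (RL_conv R alpha forcing t)%:C) +
    \sum_(0 <= k < N) (lambda ^+ k.+1 * (lambda * y0%:C) *
       (RL_conv R alpha (fun r => A k (r - tau)) t)%:C +
      lambda ^+ k.+1 * (RL_conv R alpha (fun r => B k (r - tau)) t)%:C).
  rewrite /delay_series big_nat_recl//; congr (_ + _).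
    by rewrite expr0 mul1r /A /B /order mulr0 add0r mul0r subr0.
  apply: eq_bigr => k _.
  rewrite RL_conv_shiftS ?RL_conv_shiftS//; last exact: causal_kernel1.
  by rewrite mulrDr mulrA.
apply: has_RL_convD => //.
  apply: has_RL_convD => //; first by apply: has_RL_convZ => //; exact: causal_kernel1.
  have := has_RL_convZ _ alpha t forcing 1 alpha0 causal_forcing.
  rewrite mul1r; apply: eq_has_RL_conv => r _; by rewrite mul1r.
have causal_shift k (U : R -> R) : causal R U ->
    causal R (fun r => RL_conv R (order k) U (r - tau - k%:R * tau)).
  move=> cU; have : 0 <= tau + k%:R * tau by rewrite addr_ge0 ?mulr_ge0// ltW.
  move=> /(causal_conv_shift _ _ _ _ (order_gt0 k)) /(_ cU) causal_sub.
  apply: (eq_ind _ (causal R) causal_sub).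
  by apply/funext => r; rewrite opprD addrA.
apply: has_RL_conv_sum => // k; apply: has_RL_convD => //.
  by apply: has_RL_convZ => //; apply: causal_shift; exact: causal_kernel1.
by apply: has_RL_convZ => //; exact: causal_shift.
Qed.

Lemma delay_series_solutionP (phi : R -> R) :
  (forall t, - tau <= t <= 0 -> phi t = y0) ->
  delay_solution alpha tau lambda f phi delay_series_solution.
Proof.
move=> phiE; split.
- exact: continuous_subspaceT continuous_delay_series_solution.
- by move=> t t0; rewrite phiE// delay_series_solution_le0//; case/andP : t0.
- move=> t t0; rewrite phiE ?lexx ?oppr_le0 ?ltW//.
  pose N := (Num.truncn (t / tau)).+1.
  have tN : t <= N%:R * tau by rewrite -ler_pdivrMr// ltW// truncnS_gt.
  (* The integral has one term more than the chosen N, so the solution is also expanded to N + 1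
     terms. *)
  rewrite (delay_series_integral _ _ tN) (delay_series_solutionE N.+1)//.
  by rewrite (le_trans tN)// ler_pM2r// ler_nat.
Qed.

(** The index shift behind the upper limit of the stated sum: its term 0 is the initial value, and
    its term k + 1 is the contribution of [A k]. *)
Lemma delay_series_solution_sum t : 0 <= t ->
  delay_series_solution t =
    (\sum_(0 <= k < (Num.truncn (t / tau)).+2)
       lambda ^+ k * ((t + tau - k%:R * tau) `^ (alpha * k%:R))%:C
         / (Gamma (alpha * k%:R + 1))%:C * y0%:C)
    + delay_integral alpha tau lambda f t.
Proof.
move=> t0; rewrite /delay_series_solution big_nat_recl// -addrA; congr (_ + _).
  by rewrite expr0 mulr0 powRr0 add0r Gamma1 !mul1r invr1 mul1r.
rewrite /delay_series /delay_integral -big_split/= big_nat [RHS]big_nat.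
apply: eq_bigr => k /andP[_ kn].
have kt : 0 <= t - k%:R * tau.
  rewrite subr_ge0 -ler_pdivlMr//.
  by rewrite -truncn_ge_nat// divr_ge0// ltW.
rewrite mulrDr; congr (_ + _).
  have -> : t + tau - k.+1%:R * tau = t - k%:R * tau by rewrite -natr1; ring.
  have -> : alpha * k.+1%:R = order k by rewrite /order -natr1; ring.
  rewrite /A RL_conv_kernel1// exprSr -!mulrA; congr (_ * (_ * _)).
  rewrite mulrCA mulrA mulrC; congr (_ * _).
  (* At t = k tau the kernel is 0 by convention, and so is the power, its exponent being
     positive. *)
  move: kt; rewrite le_eqVlt => /orP[/eqP <-|kt].
    by rewrite RL_kernel_le0// powR0 ?gt_eqF// mulr0.
  by rewrite RL_kernel_gt0// addrK rmorphM/= fmorphV mulrC.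
rewrite -mulrA; congr (_ * _).
rewrite /B -(RL_convE _ _ _ _ f)//.
  by rewrite rmorphM/= fmorphV.
by move=> r /andP[r0 _]; rewrite forcingE.
Qed.
End delay_series.

(* Method of steps: on [n tau, (n+1) tau] the equation only involves values at
   times at most n tau. *)
Lemma delay_solution_unique (R : realType) (alpha tau : R) (lambda : R[i])
    (f phi : R -> R) (y1 y2 : R -> R[i]) : 0 < tau ->
  delay_solution alpha tau lambda f phi y1 ->
  delay_solution alpha tau lambda f phi y2 ->
  forall t, - tau <= t -> y1 t = y2 t.
Proof.
move=> tau0 [_ init1 eq1] [_ init2 eq2].
suff step n t : - tau <= t <= n%:R * tau -> y1 t = y2 t.
  move=> t t0; apply: (step (Num.truncn (t / tau)).+1).
  by rewrite t0 -ler_pdivrMr// ltW// truncnS_gt.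
elim: n t => [|n IH] t /andP[tt tn].
  by rewrite init1 ?init2// tt/= (le_trans tn)// mul0r.
have [t0|t0] := leP t 0; first by rewrite init1 ?init2// tt.
rewrite eq1 ?eq2 ?(ltW t0)//; congr (_ + _); apply: eq_RL_integral => r /andP[r0 rt].
by rewrite IH//; move: tn; rewrite -natr1 mulrDl mul1r => tn; apply/andP; split; lra.
Qed.

Theorem corollary6 (R : realType) (alpha tau y0 : R) (lambda : R[i])
    (f phi : R -> R)
    (halpha : 0 < alpha < 1) (htau : 0 < tau)
    (hf : {within `[0, +oo[, continuous f})
    (hphi : forall t, - tau <= t <= 0 -> phi t = y0) :
  (exists y : R -> R[i], delay_solution alpha tau lambda f phi y) /\
  (forall y : R -> R[i], delay_solution alpha tau lambda f phi y ->
    forall t, 0 <= t ->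
      y t =
        (\sum_(0 <= k < (Num.truncn (t / tau)).+2)
           lambda ^+ k * ((t + tau - k%:R * tau) `^ (alpha * k%:R))%:C
             / (Gamma (alpha * k%:R + 1))%:C * y0%:C)
        + delay_integral alpha tau lambda f t).
Proof.
have /andP[alpha0 _] := halpha.
have sol := delay_series_solutionP R alpha tau y0 lambda f alpha0 htau hf phi hphi.
split; first by eexists; exact: sol.
move=> y ysol t t0; rewrite -delay_series_solution_sum//.
apply: (delay_solution_unique _ _ _ _ _ _ _ _ htau ysol sol).
by rewrite (le_trans _ t0)// oppr_le0 ltW.
Qed.
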